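(* Let $\mu$ be a Borel probability measure on $\mathbb{R}^{n+d}$ for some $n\in\mathbb{N}$ and $d\in\mathbb{N}^+$. Then $$\dim_P\mu=\sup\Big\{\gamma:\ \liminf_{r\to0+} r^{-\gamma}G_d^\mu(x,r)=0 \text{ for } \mu\text{-a.e. } x\in\mathbb{R}^{n+d}\Big\}.$$
   Context: $\mathbb{R}^0=\{0\}$. $\dim_P\mu=\inf\{\dim_P E: E\subset\mathbb{R}^{n+d}\text{ Borel}, \mu(E)>0\}$, where $\dim_P E$ is packing dimension. $D(u,r)$ denotes the closed ball of radius $r$ about $u$ in the maximum norm $\|x\|=\max_i|x_i|$. For $x\in\mathbb{R}^d$, $I_d(x)=\prod_{i=1}^d\min\{1,|x_i|^{-1}\}$ with the convention $\min\{1,0^{-1}\}=1$. For $x=(u,v)\in\mathbb{R}^n\times\mathbb{R}^d$ and $r>0$, $\mu_{u,r}$ is the Borel measure on $\mathbb{R}^d$ given by $\mu_{u,r}(E)=\mu(D(u,r)\times E)$, and $$G_d^\mu(x,r)=\int_{\mathbb{R}^d} I_d\Big(\frac{y-v}{r}\Big)\,d\mu_{u,r}(y).$$ *)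

(* Defs.v *)
(* R^k is modelled as the row-vector type 'rV[R]_k, whose canonical norm
   (matrix_normedtype) is the maximum norm, and whose topology is the
   corresponding (product) topology. *)
From HB Require Import structures.
From mathcomp Require Import all_boot all_order all_algebra.
From mathcomp Require Import all_classical all_reals all_analysis.
Set Implicit Arguments. Unset Strict Implicit. Unset Printing Implicit Defensive.
Import Order.TTheory GRing.Theory Num.Theory.
Import numFieldNormedType.Exports.
Local Open Scope classical_set_scope.
Local Open Scope ring_scope.

Section Defs.
Variable R : realType.

Definition Borel (k : nat) := g_sigma_algebraType (@open 'rV[R]_k).

Definition Dball k (u : 'rV[R]_k) (r : R) : set 'rV[R]_k :=
  [set y | `|u - y| <= r].

(** I_d(x) = prod_i min{1, |x_i|^{-1}}, with min{1, 0^{-1}} = 1. *)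
Definition Ifun (d : nat) (x : 'rV[R]_d) : R :=
  \prod_(i < d) (if x ord0 i == 0 then 1 else Num.min 1 (`|x ord0 i|)^-1).

(** Upper box-counting dimension of F in R^k, using N_delta(F) = the least
    number of closed max-norm balls of radius delta covering F:
    limsup_{delta -> 0+} log N_delta(F) / (- log delta).
    (If no finite cover exists, the ratio is +oo.) *)
Definition box_ratio k (F : set 'rV[R]_k) (delta : R) : \bar R :=
  ereal_inf [set ((ln (size s)%:R) / (- ln delta))%:E
            | s in [set s : seq 'rV[R]_k |
                    F `<=` \bigcup_(c in [set c | c \in s]) Dball c delta]].

Definition upper_box_dim k (F : set 'rV[R]_k) : \bar R :=
  limf_esup (box_ratio F) (0%R)^'+.

(** Packing dimension, as the modified upper box-counting dimension:
    dim_P E = inf { sup_i dim_B^upper F_i : E subset of U_i F_i }. *)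
Definition packing_dim k (E : set 'rV[R]_k) : \bar R :=
  ereal_inf [set ereal_sup (range (fun i => upper_box_dim (F i)))
            | F in [set F : nat -> set 'rV[R]_k | E `<=` \bigcup_i F i]].

Definition packing_dim_measure k (mu : {measure set (Borel k) -> \bar R}) : \bar R :=
  ereal_inf [set packing_dim E | E in [set E : set (Borel k) |
                                        measurable E /\ (0 < mu E)%E]].

Variables n d : nat.

Lemma norm_rsubmx (x : 'rV[R]_(n + d)) : `|rsubmx x| <= `|x|.
Proof.
change (mx_norm (rsubmx x) <= mx_norm x); rewrite !mx_normrE; apply/bigmax_leP; split.
  by rewrite bigmax_idl le_max lexx.
move=> [i j] _ /=; rewrite mxE.
exact: (le_bigmax _ _ (i, rshift n j)).
Qed.

Lemma norm_lsubmx (x : 'rV[R]_(n + d)) : `|lsubmx x| <= `|x|.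
Proof.
change (mx_norm (lsubmx x) <= mx_norm x); rewrite !mx_normrE; apply/bigmax_leP; split.
  by rewrite bigmax_idl le_max lexx.
move=> [i j] _ /=; rewrite mxE.
exact: (le_bigmax _ _ (i, lshift d j)).
Qed.

Lemma rsubmx_continuous : continuous (@rsubmx R 1 n d).
Proof.
move=> x; apply/(@cvgrPdist_lt _ _ _ (nbhs x) (nbhs_filter x)) => e e0; near=> y.
rewrite -linearB /=; apply: le_lt_trans (norm_rsubmx _) _.
near: y; change (\forall y \near x, `|x - y| < e); apply/nbhs_ballP; exists e => // z; rewrite -ball_normE.
Unshelve. all: by end_near. Qed.

Lemma lsubmx_continuous : continuous (@lsubmx R 1 n d).
Proof.
move=> x; apply/(@cvgrPdist_lt _ _ _ (nbhs x) (nbhs_filter x)) => e e0; near=> y.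
rewrite -linearB /=; apply: le_lt_trans (norm_lsubmx _) _.
near: y; change (\forall y \near x, `|x - y| < e); apply/nbhs_ballP; exists e => // z; rewrite -ball_normE.
Unshelve. all: by end_near. Qed.

Definition cyl (u : 'rV[R]_n) (r : R) : set (Borel (n + d)) :=
  (@lsubmx R 1 n d) @^-1` Dball u r.

Lemma cyl_measurable u r : measurable (cyl u r).
Proof.
have cC : closed (cyl u r).
  apply: preimage_closed; first by move=> x _; exact: lsubmx_continuous.
  exact: closed_closed_ball_.
rewrite -[cyl u r]setCK; apply: measurableC; apply: sub_sigma_algebra.
exact: closed_openC.
Qed.

Lemma rsubmx_measurable :
  measurable_fun [set: Borel (n + d)] (@rsubmx R 1 n d : Borel (n + d) -> Borel d).
Proof.
apply: (@measurability _ _ (Borel (n + d)) (Borel d) _ _ (@open 'rV[R]_d)) => //.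
move=> _ [B oB <-]; apply: sub_sigma_algebra; rewrite setTI.
by apply: open_comp => // x _; exact: rsubmx_continuous.
Qed.

(** mu_{u,r}(E) = mu(D(u,r) x E): the push-forward by the projection onto
    the last d coordinates of mu restricted to D(u,r) x R^d. *)
Definition mu_ur (mu : {measure set (Borel (n + d)) -> \bar R})
  (u : 'rV[R]_n) (r : R) : {measure set (Borel d) -> \bar R} :=
  @measure_function_pushforward__canonical__measure_function_Measure
    _ _ _ _ _ (mrestr mu (cyl_measurable u r)) _ rsubmx_measurable.

Lemma mu_urE mu u r (E : set (Borel d)) :
  mu_ur mu u r E = mu (cyl u r `&` (@rsubmx R 1 n d) @^-1` E).
Proof. by rewrite /= /pushforward /mrestr setIC. Qed.

Definition Gfun (mu : {measure set (Borel (n + d)) -> \bar R})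
  (x : 'rV[R]_(n + d)) (r : R) : \bar R :=
  (\int[mu_ur mu (lsubmx x) r]_y (Ifun (r^-1 *: (y - rsubmx x)))%:E)%E.

End Defs.

(* Main.v *)
(* Write m = n + d.

   If liminf r^-g G(x,r) > 0 on a set that is not null, then for some c and r0
   a bounded set A with non-null closure satisfies G(x,r) >= c r^g for all x in
   A and r < r0.  Cut a cube containing A into cells of side r and pick a point
   x_q of A in each of the N cells that A meets.  Then
     N c r^g <= sum_q G(x_q,r) <= int sum_q I_m((z - x_q)/r) dmu(z),
   and the integrand is at most the m-th power of a harmonic sum with O(1/r)
   terms, hence O(r^-e) for every e > 0.  So A has upper box dimension at most g.

   Conversely let F have upper box dimension less than s < g.  At scale r
   it is covered by O(r^-s) balls, and those of mass at most r^g have total mass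
   O(r^(g-s)).  Since G(x,r) >= mu(D(x,r)), Borel-Cantelli along r = e 2^-j
   shows that liminf r^-g G(x,r) > 0 for almost every x in F. *)
Require Import Defs.
From HB Require Import structures.
From mathcomp Require Import all_boot all_order all_algebra.
From mathcomp Require Import all_classical all_reals all_analysis.
From mathcomp Require Import measurable_realfun.
From mathcomp Require Import ring lra zify.
Set Implicit Arguments. Unset Strict Implicit. Unset Printing Implicit Defensive.
Import Order.TTheory GRing.Theory Num.Theory.
Import numFieldNormedType.Exports.
Local Open Scope classical_set_scope.
Local Open Scope ring_scope.

(** * Harmonic sums and the kernel summed over a grid *)

Section GridSums.
Variable R : realType.
Implicit Types (t w x r : R) (K : nat).

(** Equal to min{1, |t|^-1} with value 1 at t = 0; the maximum avoids a case distinction at 0 and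
    makes continuity visible. *)
Definition Ifactor t : R := (Num.max 1 `|t|)^-1.

Lemma Ifactor_ge0 t : 0 <= Ifactor t.
Proof. by rewrite invr_ge0 le_max ler01. Qed.

Lemma Ifactor_eq1 t : `|t| <= 1 -> Ifactor t = 1.
Proof. by move=> t1; rewrite /Ifactor max_l ?invr1. Qed.

Lemma IfunE k (x : 'rV[R]_k) : Ifun x = \prod_(i < k) Ifactor (x ord0 i).
Proof.
apply: eq_bigr => i _; rewrite /Ifactor; have [->|x0] := eqVneq.
  by rewrite normr0 max_l// invr1.
have nx0 : 0 < `|x ord0 i| by rewrite normr_gt0.
have [x1|x1] := leP 1 `|x ord0 i|.
  by rewrite min_r// invf_le1.
by rewrite invr1 min_l// invf_ge1// ltW.
Qed.

Definition harm K : R := \sum_(j < K) j.+1%:R^-1.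

Lemma harmS K : harm K.+1 = harm K + K.+1%:R^-1.
Proof. by rewrite /harm big_ord_recr. Qed.

Lemma harm_ge0 K : 0 <= harm K.
Proof. by apply: sumr_ge0 => j _; rewrite invr_ge0. Qed.

(* Drop the end point of [0, K] farther from [w]: its term is at most
   [2 / K.+1], the increment of the right-hand side. *)
Lemma sum_inv_dist_le K (w : nat) :
  \sum_(k < K) (1 + `|w%:R - k%:R|)^-1 <= 2 * harm K.
Proof.
elim: K w => [|K IH] w; first by rewrite big_ord0 /harm big_ord0 mulr0.
have end_le t : K.+1%:R <= 2 * t -> t^-1 <= 2 * K.+1%:R^-1.
  move=> h; have K0 : 0 < K.+1%:R :> R by rewrite ltr0n.
  have t0 : 0 < t by lra.
  by rewrite -ler_pdivrMl// -invfM lef_pV2 ?posrE ?mulr_gt0//; lra.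
rewrite harmS mulrDr.
have [/andP[w0 hw]|hw] := boolP ((0 < w) && (K.+1 <= 2 * w.+1))%N.
  rewrite big_ord_recl/= addrC; apply: lerD; last first.
    rewrite subr0 normr_nat nat1r; apply: end_le.
    by rewrite -natrM ler_nat.
  apply: le_trans (IH w.-1); rewrite le_eqVlt; apply/orP; left; apply/eqP.
  apply: eq_bigr => k _; congr (1 + `|_|)^-1.
  by rewrite -[in LHS](prednK w0) /bump /= !add1n -natr1 -[k.+1%:R]natr1; ring.
rewrite big_ord_recr/=; apply: lerD; first exact: IH.
have wK : (w <= K)%N by lia.
rewrite distrC -natrB// normr_nat nat1r; apply: end_le.
by rewrite -natrM ler_nat; lia.
Qed.

(** The increment 1/(K+2) is at most ln(K+2) - ln(K+1): this is ln(1+x) <= x at x = -1/(K+2). *)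
Lemma harm_le_ln K : harm K.+1 <= 1 + ln K.+1%:R.
Proof.
elim: K => [|K IH]; first by rewrite harmS /harm big_ord0 ln1 add0r addr0 invr1.
rewrite harmS.
have a0 : 0 < K.+1%:R :> R by rewrite ltr0n.
have b0 : 0 < K.+2%:R :> R by rewrite ltr0n.
have b1 : K.+2%:R = K.+1%:R + 1 :> R by rewrite natr1.
have /(@le_ln1Dx R) : -1 < - (K.+2%:R : R)^-1.
  by rewrite ltrN2 invf_lt1// ltr1n.
have -> : 1 + - (K.+2%:R : R)^-1 = K.+1%:R / K.+2%:R.
  have -> : K.+1%:R = K.+2%:R - 1 :> R by rewrite b1 addrK.
  by rewrite mulrBl mul1r divff// gt_eqF.
rewrite ln_div ?posrE// => h; move: IH h.
by move: (ln K.+1%:R) (ln K.+2%:R) (K.+2%:R^-1) (harm K.+1) => a b c e; lra.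
Qed.

Lemma harm_le_powR (e : R) K : 0 < e -> harm K <= (1 + e^-1) * K%:R `^ e.
Proof.
move=> e0; case: K => [|K].
  by rewrite /harm big_ord0 mulr_ge0 ?powR_ge0// addr_ge0// invr_ge0 ltW.
apply: le_trans (harm_le_ln K) _; rewrite mulrDl mul1r; apply: lerD.
  by rewrite -[leLHS](powRr0 (K.+1%:R : R)) ler_powR// ?ler1n// ltW.
(* ln y = ln(y^e)/e, and the logarithm lies below the identity. *)
rewrite -(mulKf (lt0r_neq0 e0) (ln _)) ler_pM2l ?invr_gt0// -ln_powR ltW// ln_sublinear//.
Qed.

(** [Num.truncn] sends negative reals to 0. Here [x] will be a coordinate of a grid point, hence
    nonnegative, while [w] may lie outside the grid; clipping [w] at 0 moves it no farther from
    [x]. *)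
Lemma truncn_dist w x : 0 <= x ->
  `|(Num.truncn w)%:R - (Num.truncn x)%:R| <= `|w - x| + 1.
Proof.
move=> x0; have /andP[x1 x2] := truncn_itv x0; rewrite -natr1 in x2.
have [w0|w0] := leP 0 w.
  have /andP[w1 w2] := truncn_itv w0; rewrite -natr1 in w2.
  by rewrite ler_norml; case: (ger0P (w - x)) => h; apply/andP; split; lra.
rewrite (_ : Num.truncn w = 0%N); last by apply/truncn0Pn; rewrite -ltNge; lra.
rewrite sub0r normrN normr_nat distrC ger0_norm; lra.
Qed.

(** 1 + D <= 2 + a <= 3 max(1, a), where a = |w - x| and D is the distance of the truncations. *)
Lemma Ifactor_le_truncn w x : 0 <= x ->
  Ifactor (w - x) <= 3 * (1 + `|(Num.truncn w)%:R - (Num.truncn x)%:R|)^-1.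
Proof.
move=> x0; have := truncn_dist w x0; set D := `|_ - (Num.truncn x)%:R|.
have D0 : 0 <= D by exact: normr_ge0.
rewrite /Ifactor; set a := `|w - x| => Da.
have [a1 a2] : 1 <= Num.max 1 a /\ a <= Num.max 1 a.
  by split; rewrite le_max lexx ?orbT.
by rewrite -ler_pdivrMl// -invfM lef_pV2 ?posrE ?mulr_gt0//; lra.
Qed.

(* [q] is the grid cell, of side [r] and counted from the corner
   [(-M, ..., -M)], that contains [p q]. *)
Lemma sum_Ifun_grid m K (Q : {set {ffun 'I_m -> 'I_K}})
    (p : {ffun 'I_m -> 'I_K} -> 'rV[R]_m) (r M : R) (z : 'rV[R]_m) : 0 < r ->
  (forall q i, q \in Q -> 0 <= (p q ord0 i + M) / r /\
                 Num.truncn ((p q ord0 i + M) / r) = q i :> nat) ->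
  \sum_(q in Q) Ifun (r^-1 *: (z - p q)) <= (6 * harm K) ^+ m.
Proof.
move=> r0 pQ; pose w i := Num.truncn ((z ord0 i + M) / r).
pose h i (k : 'I_K) : R := 3 * (1 + `|(w i)%:R - k%:R|)^-1.
have h0 i k : 0 <= h i k by rewrite mulr_ge0// invr_ge0 addr_ge0.
apply: (@le_trans _ _ (\sum_(q : {ffun 'I_m -> 'I_K}) \prod_i h i (q i))).
  rewrite big_mkcond/=; apply: ler_sum => q _; case: ifPn => [qQ|_]; last first.
    by apply: prodr_ge0.
  rewrite IfunE; apply: ler_prod => i _; rewrite Ifactor_ge0/=.
  have [p0 pq] := pQ q i qQ.
  have := Ifactor_le_truncn ((z ord0 i + M) / r) p0; rewrite pq; apply: le_trans.
  by rewrite !mxE le_eqVlt; apply/orP; left; apply/eqP; congr Ifactor; field; rewrite gt_eqF.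
(* Over all multi-indices the sum of products is a product of one-dimensional sums, each at most 3 *
   2 * [harm K]. *)
rewrite -(bigA_distr_bigA (fun i k => h i k)).
rewrite -[X in _ <= _ ^+ X]card_ord -prodr_const; apply: ler_prod => i _.
rewrite sumr_ge0//= -mulr_sumr; have := sum_inv_dist_le K (w i); lra.
Qed.

Lemma powRN_inv r x : 0 <= r -> r `^ (- x) = r^-1 `^ x.
Proof. by move=> r0; rewrite -powR_inv1// -powRrM mulN1r. Qed.

End GridSums.

(** * Comparison of G with the full kernel and with the measure of balls *)

Section Kernel.
Variable R : realType.

Lemma closed_Borel_measurable k (A : set 'rV[R]_k) :
  closed A -> measurable (A : set (Borel R k)).
Proof.
move=> cA; rewrite -[A]setCK; apply: measurableC; apply: sub_sigma_algebra.
exact: closed_openC.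
Qed.

Lemma closed_Dball k (u : 'rV[R]_k) (r : R) : closed (Dball u r).
Proof. exact: closed_closed_ball_. Qed.

Lemma Dball_measurable k (u : 'rV[R]_k) (r : R) :
  measurable (Dball u r : set (Borel R k)).
Proof. by apply: closed_Borel_measurable; exact: closed_Dball. Qed.

Lemma mx_coord_le k (x : 'rV[R]_k) i : `|x ord0 i| <= `|x|.
Proof.
change (`|x ord0 i| <= mx_norm x); rewrite mx_normrE.
exact: (le_bigmax _ _ (ord0, i)).
Qed.

Lemma mx_norm_le k (x : 'rV[R]_k) (r : R) : 0 <= r ->
  (forall i, `|x ord0 i| <= r) -> `|x| <= r.
Proof.
move=> r0 xr; change (mx_norm x <= r); rewrite mx_normrE; apply/bigmax_leP.
by split=> // -[i j] _ /=; rewrite ord1.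
Qed.

Lemma continuous_Borel_measurable k (f : 'rV[R]_k -> R) :
  continuous f -> measurable_fun [set: Borel R k] (f : Borel R k -> R).
Proof.
move=> cf; apply: (measurability _ (RGenOpens.measurableE R)).
move=> _ [_ [a [b ->] <-]]; rewrite setTI; apply: sub_sigma_algebra.
by apply: open_comp => [x _|]; [exact: cf|exact: interval_open].
Qed.

Lemma measurable_Ifun k (c : R) (v : 'rV[R]_k) :
  measurable_fun [set: Borel R k]
    ((fun y => (Ifun (c *: (y - v)))%:E) : Borel R k -> \bar R).
Proof.
apply/measurable_EFinP; under eq_fun do rewrite IfunE.
apply: measurable_prod => i _.
have mc : measurable_fun [set: Borel R k]
    ((fun y : 'rV[R]_k => y ord0 i) : Borel R k -> R).
  by apply: continuous_Borel_measurable; exact: coord_continuous.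
have mI : measurable_fun [set: R] (@Ifactor R).
  apply: continuous_measurable_fun => t; apply: cvgV.
    by rewrite gt_eqF// lt_max ltr01.
  apply: (@continuous_max R R (cst 1) Num.norm); first exact: cvg_cst.
  exact: norm_continuous.
have ml : measurable_fun [set: Borel R k]
    ((fun y : 'rV[R]_k => c * (y ord0 i - v ord0 i)) : Borel R k -> R).
  by apply: measurable_funM => //; apply: measurable_funB.
rewrite (_ : (fun y => _) = @Ifactor R \o
    (fun y : 'rV[R]_k => c * (y ord0 i - v ord0 i))); last first.
  by apply/funext => y; rewrite /= !mxE.
exact: measurableT_comp mI ml.
Qed.

Lemma Ifun_ge0 k (x : 'rV[R]_k) : 0 <= Ifun x.
Proof. by rewrite IfunE; apply: prodr_ge0 => i _; exact: Ifactor_ge0. Qed.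

Lemma Ifun_eq1 k (x : 'rV[R]_k) : `|x| <= 1 -> Ifun x = 1.
Proof.
move=> x1; rewrite IfunE big1// => i _; apply: Ifactor_eq1.
exact: le_trans (mx_coord_le _ _) x1.
Qed.

Lemma Ifun_split n d (x : 'rV[R]_(n + d)) :
  Ifun x = Ifun (lsubmx x) * Ifun (rsubmx x).
Proof.
rewrite !IfunE big_split_ord/=; congr (_ * _);
by apply: eq_bigr => i _; rewrite mxE.
Qed.

Local Open Scope ereal_scope.

Lemma ge0_integral_mrestr (dd : measure_display) (T : measurableType dd)
    (mu : {measure set T -> \bar R}) (D : set T) (mD : measurable D)
    (f : T -> \bar R) :
  measurable_fun setT f -> (forall x, 0 <= f x) ->
  \int[mrestr mu mD]_x f x = \int[mu]_(x in D) f x.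
Proof.
move=> mf f0; rewrite -(setUv D) ge0_integral_setU//=.
- rewrite [X in _ + X](eq_measure_integral mzero) ?integral_measure_zero ?adde0.
    by apply: eq_measure_integral => A mA AD; rewrite /= /mrestr setIidl.
  by move=> A mA /disjoints_subset AD; rewrite /= /mrestr /mzero AD measure0.
- exact: measurableC.
- by rewrite setUv.
- by apply/disj_setPS => x [].
Qed.

Variables (n d : nat) (mu : {measure set (Borel R (n + d)) -> \bar R}).
Implicit Types x : 'rV[R]_(n + d).

(** Undoes the push-forward, so that G becomes an integral against [mu] itself. *)
Lemma GfunE x r : Gfun mu x r =
  \int[mu]_(z in cyl (lsubmx x) r) (Ifun (r^-1 *: (rsubmx z - rsubmx x)))%:E.
Proof.
rewrite /Gfun ge0_integral_pushforward//=; last 3 first.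
- exact: rsubmx_measurable.
- exact: measurable_Ifun.
- by move=> y _; rewrite lee_fin Ifun_ge0.
rewrite preimage_setT ge0_integral_mrestr//.
- by apply: (measurableT_comp (measurable_Ifun _ _)); exact: rsubmx_measurable.
- by move=> z; rewrite lee_fin Ifun_ge0.
Qed.

Lemma Gfun_ge0 x r : 0 <= Gfun mu x r.
Proof. by apply: integral_ge0 => y _; rewrite lee_fin Ifun_ge0. Qed.

Lemma cyl_scale x z (r : R) : (0 < r)%R -> cyl (lsubmx x) r z ->
  (`|lsubmx (r^-1 *: (z - x))| <= 1)%R.
Proof.
move=> r0; rewrite /cyl/= /Dball/= => h.
rewrite linearZ/= normrZ gtr0_norm ?invr_gt0// linearB/= distrC.
by rewrite ler_pdivrMl// mulr1.
Qed.

(** On the cylinder the first [n] coordinates of (z - x)/r have modulus at most 1, so their factors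
    equal 1 and the two kernels agree there. Enlarging the domain only adds a nonnegative
    integrand. *)
Lemma Gfun_le_kernel x (r : R) : (0 < r)%R ->
  Gfun mu x r <= \int[mu]_z (Ifun (r^-1 *: (z - x)))%:E.
Proof.
move=> r0; rewrite GfunE.
rewrite (eq_integral (fun z : Borel R (n + d) =>
    (Ifun (r^-1 *: ((z : 'rV[R]_(n + d)) - x)))%:E)); last first.
  move=> z /set_mem zc; rewrite (Ifun_split (_ *: _)) (Ifun_eq1 (x := lsubmx _)) ?mul1r.
    by congr (Ifun _)%:E; apply/rowP => i; rewrite !mxE.
  exact: cyl_scale.
apply: ge0_subset_integral => //; first exact: cyl_measurable.
- exact: measurable_Ifun.
- by move=> z _; rewrite lee_fin Ifun_ge0.
Qed.

(** D(x, r) lies in the cylinder, and the kernel equals 1 on it. *)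
Lemma Gfun_ge_ball x (r : R) : (0 < r)%R -> mu (Dball x r) <= Gfun mu x r.
Proof.
move=> r0; rewrite GfunE.
have mI : measurable_fun setT (fun z : Borel R (n + d) =>
    (Ifun (r^-1 *: (rsubmx z - rsubmx x)))%:E).
  by apply: (measurableT_comp (measurable_Ifun _ _)); exact: rsubmx_measurable.
apply: (@le_trans _ _ (\int[mu]_(z in Dball x r)
    (Ifun (r^-1 *: (rsubmx z - rsubmx x)))%:E)).
  rewrite (eq_integral (cst 1)) ?integral_cst ?mul1e//; last 2 first.
  - exact: Dball_measurable.
  - move=> z /set_mem zc; rewrite Ifun_eq1//.
    rewrite normrZ gtr0_norm ?invr_gt0// -linearB/= ler_pdivrMl// mulr1.
    by apply: le_trans (norm_rsubmx _) _; rewrite distrC.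
apply: ge0_subset_integral => //.
- exact: Dball_measurable.
- exact: cyl_measurable.
- exact: measurable_funTS.
- by move=> z _; rewrite lee_fin Ifun_ge0.
- move=> z zD; rewrite /cyl/= /Dball/= -linearB/=.
  exact: le_trans (norm_lsubmx _) zD.
Qed.

End Kernel.

(** * Finite covers and upper box dimension *)

Section BoxDim.
Variable R : realType.

Definition covers k (s : seq 'rV[R]_k) (r : R) (F : set 'rV[R]_k) :=
  F `<=` \bigcup_(c in [set c | c \in s]) Dball c r.

(** A finite union of closed balls is closed. Box-dimension bounds thus pass to closures, which are
    Borel. *)
Lemma covers_closure k (s : seq 'rV[R]_k) (r : R) F :
  covers s r F -> covers s r (closure F).
Proof.
rewrite /covers => sF; have /closure_id -> : closed
    (\bigcup_(c in [set c | c \in s]) Dball c r).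
  rewrite bigcup_seq; apply: closed_bigsetU => c _; exact: closed_Dball.
exact: closureS.
Qed.

Lemma near_right0P (P : R -> Prop) :
  (\forall x \near 0^'+, P x) <->
  (exists2 e, 0 < e & forall x, 0 < x < e -> P x).
Proof.
split=> [|[e e0 eP]].
  case/nbhs_ballP => e e0 eP; exists e => // x /andP[x0 xe]; apply: eP => //.
  by rewrite -ball_normE /ball_ /= sub0r normrN gtr0_norm.
exists e => // x; rewrite /ball_/= sub0r normrN => xe x0.
by apply: eP; rewrite x0 (le_lt_trans (ler_norm _)).
Qed.

Lemma limf_einf_gt0P (f : R -> \bar R) :
  (0%:E < limf_einf f 0^'+)%E <->
  (exists2 c, 0 < c & exists2 e, 0 < e &
     forall r, 0 < r < e -> (c%:E <= f r)%E).
Proof.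
rewrite limf_einfE; split=> [|[c c0 [e e0 ef]]].
  move=> /ereal_sup_gt[_ [V V0 <-]] lt0.
  (* The infimum may be [+oo]; then any positive c will do. *)
  have [c c0 cV] : exists2 c : R, 0 < c & (c%:E <= ereal_inf (f @` V))%E.
    move: lt0; case: (ereal_inf _) => [c| |]//.
      by rewrite lte_fin => c0; exists c.
    by exists 1 => //; rewrite leey.
  exists c => //; move/near_right0P : V0 => [e e0 eV]; exists e => // r re.
  by apply: le_trans cV _; apply: ereal_inf_lbound; exists r => //; exact: eV.
apply: (@lt_le_trans _ _ c%:E); first by rewrite lte_fin.
pose V := [set r : R | 0 < r < e].
apply: (@le_trans _ _ (ereal_inf (f @` V))).
  by apply: le_ereal_inf_tmp => _ [r re <-]; exact: ef.
apply: ereal_sup_ubound; exists V => //.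
by apply/near_right0P; exists e.
Qed.

(** For r < 1 the factor - ln r is positive, and a nonempty cover has its size in the range where ln
    is monotone. *)
Lemma upper_box_dim_le k (F : set 'rV[R]_k) (t : R) :
  (\forall r \near 0^'+, exists s : seq 'rV[R]_k,
     [/\ covers s r F, (0 < size s)%N & (size s)%:R <= r `^ (- t)]) ->
  (upper_box_dim F <= t%:E)%E.
Proof.
move=> hF; rewrite /upper_box_dim limf_esupE.
pose V := [set r : R | [/\ 0 < r, r < 1 & exists s : seq 'rV[R]_k,
     [/\ covers s r F, (0 < size s)%N & (size s)%:R <= r `^ (- t)]]].
apply: (@le_trans _ _ (ereal_sup (box_ratio F @` V))%E).
  apply: ereal_inf_lbound; exists V => //.
  near=> r; split; [by near: r; exact: nbhs_right_gt|by near: r; exact: nbhs_right_lt|].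
  by near: r.
apply: ge_ereal_sup => _ [r [r0 r1 [s [sF s0 st]]] <-].
apply: (@le_trans _ _ (((ln (size s)%:R) / (- ln r))%:E)%E).
  by apply: ereal_inf_lbound; exists s.
have lr : 0 < - ln r by rewrite oppr_gt0 ln_lt0// r0.
rewrite lee_fin ler_pdivrMr// mulrN -mulNr -ln_powR ler_ln// ?posrE ?ltr0n//.
exact: powR_gt0.
Unshelve. all: by end_near. Qed.

Lemma upper_box_dim_ltP k (F : set 'rV[R]_k) (t : R) :
  (upper_box_dim F < t%:E)%E ->
  \forall r \near 0^'+, exists s : seq 'rV[R]_k,
     covers s r F /\ (size s)%:R <= r `^ (- t).
Proof.
rewrite /upper_box_dim limf_esupE => /ereal_inf_lt[_ [V V0 <-]] Vt.
near=> r.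
have r0 : 0 < r by near: r; exact: nbhs_right_gt.
have r1 : r < 1 by near: r; exact: nbhs_right_lt.
have Vr : V r by near: r.
have : (box_ratio F r < t%:E)%E.
  by apply: le_lt_trans Vt; apply: ereal_sup_ubound; exists r.
move=> /ereal_inf_lt[_ [s sF <-]]; rewrite lte_fin => st; exists s; split => //.
have lr : 0 < - ln r by rewrite oppr_gt0 ln_lt0// r0.
have [->|s0] := posnP (size s); first exact: powR_ge0.
rewrite -ler_ln ?posrE ?ltr0n// ?powR_gt0// ln_powR mulNr -mulrN.
by move: st; rewrite ltr_pdivrMr// => /ltW.
Unshelve. all: by end_near. Qed.

Lemma packing_dim_le_upper_box k (F : set 'rV[R]_k) :
  (packing_dim F <= upper_box_dim F)%E.
Proof.
apply: ge_ereal_inf; exists (ereal_sup (range (fun _ : nat => upper_box_dim F))).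
  by exists (fun=> F) => // x Fx; exists 0%N.
by apply: ge_ereal_sup => _ [i _ <-].
Qed.

End BoxDim.

(** * Lower bounds on G give upper bounds on box dimension *)

Section LowerBound.
Variables (R : realType) (n d : nat) (mu : probability (Borel R (n + d)) R).
Local Notation m := (n + d)%N.

Lemma Gfun_grid_cover (A : set 'rV[R]_m) (M r c : R) : 0 < r ->
  A !=set0 -> (forall x, A x -> `|x| <= M) ->
  (forall x, A x -> (c%:E <= Gfun mu x r)%E) ->
  exists s : seq 'rV[R]_m, [/\ covers s r A, (0 < size s)%N &
    (size s)%:R * c <= (6 * harm R (Num.truncn (2 * M / r)).+1) ^+ m].
Proof.
move=> r0 [a Aa] AM Ac; set K := Num.truncn _.
(* Coordinates lie in [-M, M], so the shifted quotients lie in [0, 2M/r] and K + 1 cells per axis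
   suffice. *)
pose w (x : 'rV[R]_m) i := (x ord0 i + M) / r.
have w0 x i : A x -> 0 <= w x i.
  move=> Ax; rewrite divr_ge0 ?(ltW r0)//.
  by have := le_trans (mx_coord_le x i) (AM _ Ax); rewrite ler_norml => /andP[]; lra.
have wK x i : A x -> (Num.truncn (w x i) < K.+1)%N.
  move=> Ax; rewrite ltnS; apply: le_truncn; rewrite ler_pM2r ?invr_gt0//.
  by have := le_trans (mx_coord_le x i) (AM _ Ax); rewrite ler_norml => /andP[]; lra.
pose cell x : {ffun 'I_m -> 'I_K.+1} := [ffun i => inord (Num.truncn (w x i))].
have cellE x i : A x -> cell x i = Num.truncn (w x i) :> nat.
  by move=> Ax; rewrite ffunE inordK// wK.
pose C q := [set x | A x /\ cell x = q].
(* The default 0 is taken only on cells that miss [A], which [Q] leaves out. *)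
pose p q := xget 0 (C q).
pose Q := [set q | `[< C q !=set0 >]]%SET.
have pQ q : q \in Q -> C q (p q).
  by rewrite inE => /asboolP[x Cx]; exact: (xgetPex 0 (ex_intro _ x Cx)).
have QA x : A x -> cell x \in Q by move=> Ax; rewrite inE; apply/asboolP; exists x.
exists [seq p q | q <- enum Q]; rewrite size_map -cardE; split.
- move=> x Ax; have [Ap cp] := pQ _ (QA _ Ax).
  exists (p (cell x)); first by apply: map_f; rewrite mem_enum QA.
  rewrite /Dball/=; apply: mx_norm_le => [|i]; first exact: ltW.
  (* Equal integer parts in every coordinate put [x] and its representative within r in the maximum
     norm. *)
  have := congr1 (fun q : {ffun _} => nat_of_ord (q i)) cp; rewrite !cellE// => e.
  have := truncn_itv (w0 _ i Ap); have := truncn_itv (w0 _ i Ax); rewrite e /w.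
  move: (Num.truncn _) => k.
  rewrite !ler_pdivlMr// !ltr_pdivrMr// -natr1 => /andP[h1 h2] /andP[h3 h4].
  by rewrite !mxE ler_norml; apply/andP; split; lra.
- by apply/card_gt0P; exists (cell a); exact: QA.
rewrite -lee_fin mulr_natl -sumr_const -sumEFin.
apply: (@le_trans _ _ (\sum_(q in Q)
    \int[mu]_z (Ifun (r^-1 *: ((z : 'rV[R]_m) - p q)))%:E)%E).
  apply: lee_sum => q /pQ[Ap _]; apply: le_trans (Ac _ Ap) _.
  exact: Gfun_le_kernel.
rewrite -big_enum -ge0_integral_sum//; last 2 first.
- by move=> q; exact: measurable_Ifun.
- by move=> q z _; rewrite lee_fin Ifun_ge0.
(* [mu] has total mass 1, so a pointwise bound of the integrand also bounds the integral. *)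
set B := (_ ^+ _); have -> : B%:E = (\int[mu]_z (cst B%:E) z)%E.
  by rewrite integral_cst//= [X in (_ * X)%E]probability_setT mule1.
apply: ge0_le_integral => //.
- by move=> z _; apply: sume_ge0 => q _; rewrite lee_fin Ifun_ge0.
- by apply: emeasurable_sum => q; exact: measurable_Ifun.
move=> z _; rewrite sumEFin lee_fin big_enum/=.
apply: (sum_Ifun_grid (M := M)) => // q i /pQ[Ap {3}<-].
by rewrite cellE//; split => //; exact: w0.
Qed.

Lemma Gfun_upper_box_dim (A : set 'rV[R]_m) (M c e g t : R) : 0 < c -> 0 < e ->
  A !=set0 -> (forall x, A x -> `|x| <= M) ->
  (forall x r, A x -> 0 < r < e -> ((c * r `^ g)%:E <= Gfun mu x r)%E) ->
  g < t -> (upper_box_dim (closure A) <= t%:E)%E.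
Proof.
move=> c0 e0 A0 AM AG gt; apply: upper_box_dim_le.
have M0 : 0 <= M by case: A0 => x /AM; exact: le_trans.
(* t - g is split into m + 1 equal shares: m of them pay for the m harmonic factors, each O(r^-h),
   and the last lets r^h absorb the constants. *)
pose h := (t - g) / m.+1%:R.
have h0 : 0 < h by rewrite divr_gt0 ?subr_gt0.
pose B := 6 * ((1 + h^-1) * (2 * M + 1) `^ h).
have B0 : 0 <= B.
  by rewrite mulr_ge0// mulr_ge0 ?powR_ge0// addr_ge0// invr_ge0 ltW.
near=> r.
have r0 : 0 < r by near: r; exact: nbhs_right_gt.
have r1 : r < 1 by near: r; exact: nbhs_right_lt.
have re : r < e by near: r; exact: nbhs_right_lt.
(* Yields B^m r^h <= c at the end; the + 1 keeps the denominator positive. *)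
have rh : r `^ h < c / (B ^+ m + 1).
  near: r; apply: cvgr_lt (powR_cvg0 h0) _ _.
  by rewrite divr_gt0// ltr_wpDl// exprn_ge0.
have [|s [sA s0 sB]] := @Gfun_grid_cover A M r (c * r `^ g) r0 A0 AM.
  by move=> x Ax; apply: AG; rewrite ?r0.
exists s; split => //; first exact: covers_closure.
have rN (a : R) : 0 < r `^ a by exact: powR_gt0.
(* For r < 1 the number of cells per axis is at most (2M + 1)/r. *)
have hK : 6 * harm R (Num.truncn (2 * M / r)).+1 <= B * r `^ (- h).
  rewrite /B -!mulrA ler_pM2l//.
  apply: le_trans (harm_le_powR _ h0) _.
  rewrite ler_pM2l ?addr_gt0 ?invr_gt0//.
  rewrite powRN_inv ?(ltW r0)//; have ri0 : 0 <= r^-1 by rewrite invr_ge0 ltW.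
  rewrite -powRM//; last by lra.
  apply: ge0_ler_powR; rewrite ?nnegrE ?(ltW h0) ?mulr_ge0//; first by lra.
  rewrite -[(Num.truncn _).+1%:R]natr1 [leRHS]mulrDl mul1r -mulrA lerD//.
    by rewrite truncn_le !mulr_ge0.
  by rewrite invf_ge1 ?(ltW r1).
have {}sB : (size s)%:R * c * r `^ g <= B ^+ m * r `^ (- (h * m%:R)).
  rewrite -mulrA; apply: le_trans sB _.
  have -> : r `^ (- (h * m%:R)) = (r `^ (- h)) ^+ m.
    by rewrite -mulNr powRrM powR_mulrn ?powR_ge0.
  rewrite -exprMn; apply: lerXn2r => //; rewrite nnegrE.
    by rewrite mulr_ge0 ?harm_ge0.
  exact: mulr_ge0 B0 (powR_ge0 _ _).
have ht : h * m%:R = t - g - h.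
  have : h * m.+1%:R = t - g by rewrite divfK.
  by rewrite -natr1 mulrDr mulr1 => <-; rewrite addrK.
have sC : (size s)%:R * c <= B ^+ m * r `^ h * r `^ (- t).
  rewrite -(ler_pM2r (rN g)); apply: le_trans sB _.
  rewrite ht -!mulrA -!powRD ?(gt_eqF r0) ?implybT//.
  by rewrite (_ : h + (- t + g) = - (t - g - h))//; ring.
rewrite -(ler_pM2r c0); apply: le_trans sC _.
rewrite [leRHS]mulrC ler_pM2r//.
move: rh; rewrite ltr_pdivlMr; last by rewrite ltr_wpDl// exprn_ge0.
by rewrite mulrDr mulr1 => h1; have := rN h; move: (r `^ h) (B ^+ m) h1 => a b; rewrite mulrC; lra.
Unshelve. all: by end_near. Qed.

End LowerBound.

(** * Covers at dyadic scales and a Borel-Cantelli argument *)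

Section UpperBound.
Variable R : realType.

Lemma measure_bigsetU_le (dd : measure_display) (T : measurableType dd)
    (mu : {measure set T -> \bar R}) (I : Type) (s : seq I) (P : pred I)
    (F : I -> set T) (a : R) : 0 <= a ->
  (forall i, measurable (F i)) -> (forall i, P i -> (mu (F i) <= a%:E)%E) ->
  (mu (\big[setU/set0]_(i <- s | P i) F i) <= ((size s)%:R * a)%:E)%E.
Proof.
move=> a0 mF Fa; elim: s => [|i s IH]; first by rewrite big_nil measure0 mul0r.
have mS : measurable (\big[setU/set0]_(i <- s | P i) F i).
  exact: bigsetU_measurable.
rewrite big_cons /= -nat1r mulrDl mul1r; case: ifPn => Pi; last first.
  by apply: le_trans IH _; rewrite lee_fin lerDr.
apply: le_trans (measureU2 mu (mF i) mS) _.
by rewrite EFinD; apply: leeD => //; exact: Fa.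
Qed.

Lemma nneseries_geometric_lty (u : nat -> \bar R) (a z : R) :
  0 <= a -> 0 <= z < 1 -> (forall j, (0 <= u j)%E) ->
  (forall j, (u j <= (a * z ^+ j)%:E)%E) -> (\sum_(0 <= j <oo) u j < +oo)%E.
Proof.
move=> a0 /andP[z0 z1] u0 ua; apply: (@le_lt_trans _ _ (a / (1 - z))%:E); last exact: ltry.
apply: lime_le; first exact: is_cvg_nneseries.
apply: nearW => N; apply: (@le_trans _ _ (series (geometric a z) N)%:E).
  by rewrite /series/= -sumEFin; apply: lee_sum => j _; exact: ua.
rewrite lee_fin geometric_seriesE ?lt_eqF//= ler_wpM2r ?invr_ge0 ?subr_ge0 ?(ltW z1)//.
by rewrite ler_piMr// lerBlDr lerDl exprn_ge0.
Qed.

(** The least j with e 2^-j <= r works: minimality gives the upper bound, and r < e 2^-J forces j >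
    J. This extends estimates from dyadic scales to all small r. *)
Lemma dyadic_scale (e r : R) (J : nat) : 0 < r -> r < e * 2^-1 ^+ J ->
  exists2 j, (J <= j)%N & e * 2^-1 ^+ j <= r < 2 * (e * 2^-1 ^+ j).
Proof.
move=> r0 rJ.
have e0 : 0 < e by rewrite -(@pmulr_lgt0 _ (2^-1 ^+ J)) ?exprn_gt0// (lt_trans r0).
have ex : exists j, e * 2^-1 ^+ j <= r.
  exists (Num.truncn (e / r)).+1; set N := _.+1.
  rewrite exprVn ler_pdivrMr ?exprn_gt0// mulrC -ler_pdivrMr//.
  apply: le_trans (ltW (truncnS_gt _)) _.
  by rewrite -natrX ler_nat ltnW// ltn_expl.
case: (ex_minnP ex) => j jr jmin.
have Jj : (J < j)%N.
  rewrite ltnNge; apply/negP => jJ; move: rJ; rewrite ltNge => /negP; apply.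
  apply: le_trans jr; rewrite ler_pM2l//; apply: ler_wiXn2l => //.
  by rewrite invf_le1// ler1n.
exists j; first exact: ltnW.
rewrite jr ltNge; apply/negP => h.
have j0 : (0 < j)%N by exact: leq_ltn_trans Jj.
have : e * 2^-1 ^+ j.-1 <= r.
  apply: le_trans h; rewrite -[in leRHS](prednK j0) exprS.
  by rewrite mulrCA mulVKf.
by move=> /jmin; rewrite leqNgt prednK// leqnn.
Qed.

Variables (n d : nat) (mu : probability (Borel R (n + d)) R).
Local Notation m := (n + d)%N.
Local Notation lower_density g x :=
  (limf_einf (fun r : R => ((powR r (- g))%:E * Gfun mu x r)%E) 0^'+).

Lemma lower_density_ge0 (g : R) (x : 'rV[R]_m) : (0 <= lower_density g x)%E.
Proof.
rewrite limf_einfE; apply: le_ereal_sup_tmp.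
exists (ereal_inf ((fun r : R => ((powR r (- g))%:E * Gfun mu x r)%E) @` setT)).
  by exists setT => //; exact: filterT.
apply: le_ereal_inf_tmp => _ [r _ <-]; apply: mule_ge0; last exact: Gfun_ge0.
by rewrite lee_fin powR_ge0.
Qed.

Lemma Dball_sub k (x c : 'rV[R]_k) (r : R) :
  Dball c r x -> Dball c r `<=` Dball x (2 * r).
Proof.
rewrite /Dball => xc y /= yc; rewrite -(subrKA c) mulr2n mulrDl mul1r.
by apply: le_trans (ler_normD _ _) _; apply: lerD => //; rewrite distrC.
Qed.

Lemma lower_density_negligible (F : set 'rV[R]_m) (s g : R) : s < g ->
  (\forall r \near 0^'+, exists l : seq 'rV[R]_m,
     covers l r F /\ (size l)%:R <= r `^ (- s)) ->
  mu.-negligible [set x : Borel R m | F x /\ lower_density g x = 0%E].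
Proof.
move=> sg /near_right0P[e e0 eF].
(* The covering radius is half the scale, so that a covering ball containing [x] lies in D(x,
   [sc j]). *)
pose sc j : R := e * 2^-1 ^+ j; pose rho j := sc j / 2.
have h0 j : 0 < 2^-1 ^+ j :> R by rewrite exprn_gt0.
have sc0 j : 0 < sc j by rewrite mulr_gt0.
have rho0 j : 0 < rho j by rewrite divr_gt0.
have scE j : sc j = 2 * rho j by rewrite mulrC divfK.
have rhoe j : rho j < e.
  have : sc j <= e.
    by rewrite ler_piMr ?(ltW e0)// exprn_ile1// invf_le1// ler1n.
  by rewrite scE; have := rho0 j; lra.
have /choice[l lP] : forall j, exists l : seq 'rV[R]_m,
    covers l (rho j) F /\ (size l)%:R <= rho j `^ (- s).
  by move=> j; apply: eF; rewrite rho0 rhoe.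
pose light j := [pred c | (mu (Dball c (rho j)) <= (sc j `^ g)%:E)%E].
pose W j : set (Borel R m) :=
  \big[setU/set0]_(c <- l j | light j c) Dball c (rho j).
have mW j : measurable (W j).
  by apply: bigsetU_measurable => c _; exact: Dball_measurable.
(* rho^-s sc^g = 2^g rho^(g-s) with rho = (e/2) 2^-j, which is a z^j; s < g makes z < 1. *)
pose a := 2 `^ g * (e / 2) `^ (g - s); pose z : R := 2^-1 `^ (g - s).
have z01 : 0 <= z < 1.
  rewrite powR_ge0/= /z; have gs : 0 < g - s by rewrite subr_gt0.
  suff : 2^-1 `^ (g - s) < 1 `^ (g - s) :> R by rewrite powR1.
  by apply: gt0_ltr_powR => //; rewrite ?nnegrE ?invf_lt1 ?ltr1n.
have muW j : (mu (W j) <= (a * z ^+ j)%:E)%E.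
  apply: le_trans (measure_bigsetU_le _ (a := sc j `^ g) _ _ _) _.
  - exact: powR_ge0.
  - by move=> c; exact: Dball_measurable.
  - by move=> c.
  rewrite lee_fin; have [_ ls] := lP j.
  apply: le_trans (ler_wpM2r (powR_ge0 _ _) ls) _.
  rewrite scE powRM ?(ltW (rho0 _))// mulrCA -powRD ?(gt_eqF (rho0 _)) ?implybT//.
  rewrite addrC /a -mulrA ler_pM2l ?powR_gt0//.
  have -> : rho j = (e / 2) * 2^-1 ^+ j by rewrite /rho /sc mulrAC.
  rewrite powRM ?divr_ge0 ?(ltW e0) ?(ltW (h0 _))//.
  by rewrite -[2^-1 ^+ j]powR_mulrn// powRAC powR_mulrn// powR_ge0.
have limW : mu (lim_sup_set W) = 0%E.
  apply: lim_sup_set_cvg0 => //.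
  by apply: (nneseries_geometric_lty (a := a) (z := z)) => //; rewrite mulr_ge0 ?powR_ge0.
have mlim : measurable (lim_sup_set W).
  by apply: bigcap_measurable => // k _; exact: bigcup_measurable.
(* If [x] avoids all [W j] with j >= J, every ball of the cover at such a scale that contains [x] is
   heavy, which makes the lower density positive. *)
exists (lim_sup_set W); split => // x [Fx x0] J _; apply: contrapT => xW.
suff : (0%E < lower_density g x)%E by rewrite x0 ltxx.
(* The ratio q of the dyadic scale to r lies in [1/2, 1], so q^g >= q^|g| >= 2^-|g|; the absolute
   value covers g < 0. *)
apply/limf_einf_gt0P; exists (2^-1 `^ `|g|); first exact: powR_gt0.
exists (sc J) => // r /andP[r0 rJ]; have [j Jj /andP[jr rj]] := dyadic_scale r0 rJ.
have [c lc xc] := (lP j).1 x Fx.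
have heavy : ((sc j `^ g)%:E < mu (Dball c (rho j)))%E.
  rewrite ltNge; apply/negP => cl; apply: xW; exists j => //.
  by rewrite /W -bigcup_seq_cond; exists c => //=; rewrite lc.
have {}heavy : ((sc j `^ g)%:E <= Gfun mu x r)%E.
  apply: le_trans (ltW heavy) (le_trans _ (Gfun_ge_ball mu x r0)).
  apply: le_measure; rewrite ?inE; [exact: Dball_measurable..|].
  move=> y /(Dball_sub xc); rewrite -scE => xy; exact: le_trans xy jr.
apply: (@le_trans _ _ ((r `^ (- g))%:E * (sc j `^ g)%:E)%E); last first.
  by apply: lee_wpmul2l => //; rewrite lee_fin powR_ge0.
rewrite -EFinM lee_fin powRN_inv ?(ltW r0)//.
rewrite -powRM ?invr_ge0 ?(ltW r0) ?(ltW (sc0 _))//; set q := r^-1 * sc j.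
have q2 : 2^-1 <= q by rewrite ler_pdivlMl// mulrC ler_pdivrMl// ltW.
have q1 : q <= 1 by rewrite ler_pdivrMl// mulr1.
have q0 : 0 < q by apply: lt_le_trans q2.
apply: (@le_trans _ _ (q `^ `|g|)).
  by apply: ge0_ler_powR => //; rewrite nnegrE ?invr_ge0// ltW.
by apply: ger_powR; rewrite ?q0 ?q1// ler_norm.
Qed.

End UpperBound.

Lemma ereal_real_between (R : realType) (x y : \bar R) : (x < y)%E ->
  exists2 r : R, (x < r%:E)%E & (r%:E < y)%E.
Proof.
move: x y => [x| |] [y| |]//=; rewrite ?lte_fin => xy.
- by exists ((x + y) / 2); rewrite lte_fin; lra.
- by exists (x + 1); rewrite ?ltry// lte_fin ltrDl.
- by exists (y - 1); rewrite ?ltNyr// lte_fin gtrBl.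
- by exists 0; rewrite ?ltNyr ?ltry.
Qed.

(** * The two inequalities between the packing dimension and the supremum *)

Section Main.
Variables (R : realType) (n d : nat) (mu : probability (Borel R (n + d)) R).
Local Notation m := (n + d)%N.
Local Notation lower_density g x :=
  (limf_einf (fun r : R => ((powR r (- g))%:E * Gfun mu x r)%E) 0^'+).

(** One integer controls the norm, the constant and the range of radii, so countably many bounded
    sets exhaust the points of nonzero lower density. *)
Definition Gheavy (g : R) (p : nat) : set 'rV[R]_m :=
  [set x | `|x| <= p.+1%:R /\
    forall r, 0 < r < p.+1%:R^-1 -> ((p.+1%:R^-1 * r `^ g)%:E <= Gfun mu x r)%E].

Lemma lower_density_neq0 (g : R) (x : 'rV[R]_m) :
  lower_density g x <> 0%E -> (\bigcup_p Gheavy g p) x.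
Proof.
move=> /eqP x0.
have /limf_einf_gt0P[c c0 [e e0 ce]] : (0%E < lower_density g x)%E.
  by rewrite lt_neqAle eq_sym x0 lower_density_ge0.
(* p + 1 exceeds |x|, 1/c and 1/e at once. *)
pose p := Num.truncn (`|x| + c^-1 + e^-1).
have pP := truncnS_gt (`|x| + c^-1 + e^-1).
have [ci ei] : 0 < c^-1 /\ 0 < e^-1 by rewrite !invr_gt0.
have nx := normr_ge0 x.
exists p => //; split=> [|r /andP[r0 rp]]; first by rewrite /p; lra.
have pc : p.+1%:R^-1 <= c.
  by rewrite invf_ple ?posrE//; rewrite /p; lra.
have pe : p.+1%:R^-1 <= e.
  by rewrite invf_ple ?posrE//; rewrite /p; lra.
have rg : 0 < r `^ g by exact: powR_gt0.
apply: (@le_trans _ _ (c * r `^ g)%:E); first by rewrite lee_fin ler_pM2r.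
have := ce r; rewrite r0 (lt_le_trans rp pe) => /(_ isT).
move=> /(lee_wpmul2l (ltW rg : (0 <= (r `^ g)%:E)%E)).
by rewrite muleA -!EFinM powRN divff ?gt_eqF// mul1e mulrC.
Qed.

(** [Gheavy g p] is replaced by its closure, which is Borel and obeys the same box-dimension bound.
    Were all these closures null, the lower density would vanish almost everywhere, since their
    union contains every point where it does not. *)
Lemma packing_dim_measure_le (g t : R) : g < t ->
  ~ {ae mu, forall x : Borel R m, lower_density g x = 0%E} ->
  (packing_dim_measure mu <= t%:E)%E.
Proof.
move=> gt nae.
have [p p0] : exists p, mu (closure (Gheavy g p)) != 0%E.
  apply: contrapT => /forallNP h; apply: nae.
  apply: (@negligibleS _ _ _ mu (\bigcup_p closure (Gheavy g p))).
    by move=> x /lower_density_neq0 [p _ px]; exists p => //; exact: subset_closure.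
  apply: negligible_bigcup => p; apply/negligibleP.
    by apply: closed_Borel_measurable; exact: closed_closure.
  by have /negP := h p; rewrite negbK => /eqP.
have A0 : Gheavy g p !=set0.
  apply/set0P; apply: contraNneq p0 => ->.
  by rewrite closure0 measure0.
apply: ge_ereal_inf; exists (packing_dim (closure (Gheavy g p))).
  exists (closure (Gheavy g p)) => //; split; last by rewrite lt0e p0 measure_ge0.
  by apply: closed_Borel_measurable; exact: closed_closure.
apply: le_trans (packing_dim_le_upper_box _) _.
apply: (@Gfun_upper_box_dim _ _ _ mu _ p.+1%:R p.+1%:R^-1 p.+1%:R^-1 g) => //.
- by move=> x [].
- by move=> x r [_]; exact.
Qed.

(** A cover of [E] by sets of upper box dimension below some s < g would make [E] null: each [F i]
    meets the zero set of the lower density in a negligible set. The [F i] may fail to be Borel,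
    hence negligibility instead of measure zero. *)
Lemma lower_density_le_packing_dim (g : R) (E : set (Borel R m)) :
  {ae mu, forall x : Borel R m, lower_density g x = 0%E} ->
  measurable E -> (0 < mu E)%E -> (g%:E <= packing_dim E)%E.
Proof.
move=> gae mE E0; apply: le_ereal_inf_tmp => _ [F EF <-].
rewrite leNgt; apply/negP => /ereal_real_between[s Fs]; rewrite lte_fin => sg.
suff : mu E = 0%E by move=> E0'; rewrite E0' ltxx in E0.
apply: measure_negligible => //.
apply: (@negligibleS _ _ _ mu
  (~` [set x : Borel R m | lower_density g x = 0%E] `|`
   \bigcup_i [set x : Borel R m | F i x /\ lower_density g x = 0%E])).
  move=> x /EF[i _ Fix]; have [x0|x0] := pselect (lower_density g x = 0%E).
    by right; exists i.
  by left.
apply: negligibleU => //; apply: negligible_bigcup => i.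
apply: (@lower_density_negligible R n d mu (F i) s g sg).
apply: upper_box_dim_ltP.
by apply: le_lt_trans Fs; apply: ereal_sup_ubound; exists i.
Qed.

End Main.

Theorem theorem2p7 (R : realType) (n d : nat) (hd : (0 < d)%N)
    (mu : probability (Borel R (n + d)) R) :
  packing_dim_measure mu =
  ereal_sup [set g%:E | g in [set g : R |
    {ae mu, forall x : Borel R (n + d),
       limf_einf (fun r : R => ((powR r (- g))%:E * Gfun mu x r)%E) 0^'+ = 0%E}]].
Proof.
apply/eqP; rewrite eq_le; apply/andP; split; last first.
  apply: ge_ereal_sup => _ [g gae <-]; apply: le_ereal_inf_tmp => _ [E [mE E0] <-].
  exact: lower_density_le_packing_dim gae mE E0.
(* Two reals are placed so that sup < g < t < dim_P mu. As g exceeds the supremum, it violates the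
   almost-everywhere condition, which forces dim_P mu <= t. *)
rewrite leNgt; apply/negP => /ereal_real_between[g gS /ereal_real_between[t]].
rewrite lte_fin => gt; rewrite ltNge => /negP; apply.
apply: packing_dim_measure_le gt _ => gae.
by move: gS; rewrite ltNge => /negP; apply; apply: ereal_sup_ubound; exists g.
Qed.
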